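(* Let $X\in\mathbb R^{n\times p}$ be a fixed design matrix, $\beta\in\mathbb R^p$ a fixed unknown coefficient vector, and $Y=X\beta+\varepsilon$, where $\varepsilon\in\mathbb R^n$ has independent coordinates with mean $0$ and variance $\sigma^2$. The $n$ rows of $(X,Y)$ are partitioned into $k$ blocks $(X_i,Y_i)$, $i=1,\dots,k$, with $X_i\in\mathbb R^{n_i\times p}$ and $Y_i\in\mathbb R^{n_i}$. For fixed regularization parameters $\lambda_i>0$ let $$\hat\beta_i(\lambda_i)=(X_i^\top X_i+n_i\lambda_i I_p)^{-1}X_i^\top Y_i,\qquad \hat\beta_{dist}(w)=\sum_{i=1}^k w_i\hat\beta_i(\lambda_i),\quad w\in\mathbb R^k .$$ Put $\hat\Sigma_i=n_i^{-1}X_i^\top X_i$ and $Q_i=(\hat\Sigma_i+\lambda_iI_p)^{-1}\hat\Sigma_i$, and define (1) $v\in\mathbb R^k$ with $i$-th coordinate $\beta^\top Q_i\beta$; (2) $A\in\mathbb R^{k\times k}$ with $(i,j)$-th entry $\beta^\top Q_iQ_j\beta$; (3) $R\in\mathbb R^{k\times k}$ diagonal with $i$-th diagonal entry $n_i^{-1}\sigma^2\operatorname{tr}[(\hat\Sigma_i+\lambda_iI_p)^{-2}\hat\Sigma_i]$. Assume $A+R$ is invertible. Then the weights that minimize the mean squared error $\mathbb E\|\hat\beta_{dist}(w)-\beta\|^2$ over $w\in\mathbb R^k$ are $$w^*=(A+R)^{-1}v,$$ and the mean squared error of the optimally weighted distributed ridge estimator equals $$\mathrm{MSE}^*_{dist}(k)=\mathbb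 E\|\hat\beta_{dist}(w^* )-\beta\|^2=\|\beta\|^2-v^\top(A+R)^{-1}v .$$
   Context: Expectations are over the noise $\varepsilon$ only ($X$ and $\beta$ are fixed). $\|\cdot\|$ is the Euclidean norm, $I_p$ the $p\times p$ identity matrix. The weights $w_i$ are arbitrary real numbers (they need not sum to one). *)

(* Defs.v *)
From HB Require Import structures.
From mathcomp Require Import all_boot all_order all_algebra.
From mathcomp Require Import all_classical all_reals all_analysis.

Set Implicit Arguments.
Unset Strict Implicit.
Unset Printing Implicit Defensive.

Import Order.TTheory GRing.Theory Num.Theory.
Import numFieldNormedType.Exports.

Local Open Scope ring_scope.

(* Mutual independence: the product rule holds for every finite subfamily. *)
Definition mutually_independent (d : measure_display) (T : measurableType d)
    (R : realType) (P : probability T R) (I : finType)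
    (Z : I -> {RV P >-> R}) : Prop :=
  forall (J : {set I}) (S : I -> set R),
    (forall i, i \in J -> measurable (S i)) ->
    P [set t | forall i, i \in J -> S i (Z i t)]%classic =
    (\prod_(i in J) P (Z i @^-1` S i)%classic)%E.

(* The library norm on matrices is the sup norm. *)
Definition enorm (R : realType) (m : nat) (u : 'cV[R]_m) : R :=
  Num.sqrt (\sum_(i < m) u i ord0 ^+ 2).

(* Value of a product of matrices that has a 1 x 1 result. *)
Definition mxscal (R : realType) (M : 'M[R]_1) : R := M ord0 ord0.

(* B i is the set of indices of the rows that go to block i.  finset.partition
   forces the blocks to be nonempty, disjoint and covering; injectivity of B
   makes blocks with different labels different. *)
Definition is_row_partition (n k : nat) (B : 'I_k -> {set 'I_n}) : Prop :=
  injective B /\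
  finset.partition [set B i | i : 'I_k]%SET [set: 'I_n]%SET.

Definition row_block (R : realType) (n m : nat) (b : {set 'I_n})
    (M : 'M[R]_(n, m)) : 'M[R]_(#|b|, m) :=
  rowsub (fun r : 'I_#|b| => enum_val r) M.

Definition ridge (R : realType) (m p : nat) (X : 'M[R]_(m, p)) (Y : 'cV[R]_m)
    (lam : R) : 'cV[R]_p :=
  invmx (X^T *m X + (m%:R * lam)%:M) *m X^T *m Y.

Definition dist_ridge (R : realType) (n p k : nat) (X : 'M[R]_(n, p))
    (Y : 'cV[R]_n) (B : 'I_k -> {set 'I_n}) (lam : 'I_k -> R)
    (w : 'cV[R]_k) : 'cV[R]_p :=
  \sum_(i < k)
    w i ord0 *: ridge (row_block (B i) X) (row_block (B i) Y) (lam i).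

Definition Sigma_hat (R : realType) (m p : nat) (X : 'M[R]_(m, p)) : 'M[R]_p :=
  m%:R^-1 *: (X^T *m X).

Definition Q_block (R : realType) (m p : nat) (X : 'M[R]_(m, p)) (lam : R) :
    'M[R]_p :=
  invmx (Sigma_hat X + lam%:M) *m Sigma_hat X.

Definition v_vec (R : realType) (n p k : nat) (X : 'M[R]_(n, p))
    (B : 'I_k -> {set 'I_n}) (lam : 'I_k -> R) (beta : 'cV[R]_p) : 'cV[R]_k :=
  \col_(i < k)
    mxscal (beta^T *m Q_block (row_block (B i) X) (lam i) *m beta).

Definition A_mx (R : realType) (n p k : nat) (X : 'M[R]_(n, p))
    (B : 'I_k -> {set 'I_n}) (lam : 'I_k -> R) (beta : 'cV[R]_p) : 'M[R]_k :=
  \matrix_(i < k, j < k)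
    mxscal (beta^T *m Q_block (row_block (B i) X) (lam i)
                   *m Q_block (row_block (B j) X) (lam j) *m beta).

Definition R_mx (R : realType) (n p k : nat) (X : 'M[R]_(n, p))
    (B : 'I_k -> {set 'I_n}) (lam : 'I_k -> R) (sigma : R) : 'M[R]_k :=
  diag_mx (\row_(i < k)
    (#|B i|%:R^-1 * sigma ^+ 2 *
     \tr (invmx (Sigma_hat (row_block (B i) X) + (lam i)%:M) ^+ 2
          *m Sigma_hat (row_block (B i) X)))).

Definition response (d : measure_display) (T : measurableType d)
    (R : realType) (P : probability T R) (n p : nat) (X : 'M[R]_(n, p))
    (beta : 'cV[R]_p) (eps : 'I_n -> {RV P >-> R}) (t : T) : 'cV[R]_n :=
  X *m beta + \col_(r < n) eps r t.

Definition MSE (d : measure_display) (T : measurableType d)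
    (R : realType) (P : probability T R) (n p k : nat) (X : 'M[R]_(n, p))
    (beta : 'cV[R]_p) (eps : 'I_n -> {RV P >-> R}) (B : 'I_k -> {set 'I_n})
    (lam : 'I_k -> R) (w : 'cV[R]_k) : \bar R :=
  ('E_P[fun t =>
    (enorm (dist_ridge X (response X beta eps t) B lam w - beta) ^+ 2)%R])%E.

(* Main.v *)
Require Import Defs.
From HB Require Import structures.
From mathcomp Require Import all_boot all_order all_algebra.
From mathcomp Require Import all_classical all_reals all_analysis.
From mathcomp Require Import measurable_realfun ring lra.

(** The error of the estimator splits as (U w - beta) + M(w) eps, where U has
    columns Q_i beta and M(w) = sum_i w_i M_i with M_i supported on the columns
    of block i.  Independence and centering turn E |a + M eps|^2 into
    |a|^2 + sigma^2 |M|_F^2, and disjointness of the blocks kills the cross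
    terms of |M(w)|_F^2.  As the Q_i are symmetric, A = U^T U and
    v = U^T beta, so the MSE equals w^T (A + R) w - 2 w^T v + |beta|^2.
    A + R is positive semidefinite, hence positive definite once it is
    invertible, and completing the square gives the unique minimizer. *)

Set Implicit Arguments.
Unset Strict Implicit.
Unset Printing Implicit Defensive.

Import Order.TTheory GRing.Theory Num.Theory.
Import numFieldNormedType.Exports.

Local Open Scope ring_scope.

(** * Expectations of products and of finite sums *)

(* The joint law is the product of the marginal laws since both agree on
   rectangles; then Fubini applies. *)
Lemma expectationM_indep (d : measure_display) (T : measurableType d)
    (R : realType) (P : probability T R) (X Y : {RV P >-> R}) :
  (forall S1 S2 : set R, measurable S1 -> measurable S2 ->
    P ((X @^-1` S1) `&` (Y @^-1` S2))%classic =
    (P (X @^-1` S1)%classic * P (Y @^-1` S2)%classic)%E) ->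
  P.-integrable setT (EFin \o X) -> P.-integrable setT (EFin \o Y) ->
  P.-integrable setT (EFin \o (X \* Y)) ->
  'E_P[X \* Y]%E = ('E_P[X] * 'E_P[Y])%E.
Proof.
move=> XY_indep X_int Y_int XY_int.
pose Z t := (X t, Y t).
have mZ : measurable_fun setT Z by exact: measurable_fun_pair.
pose mZ' := isMeasurableFun.Build _ _ _ _ _ mZ.
pose Zm : {mfun T >-> (R * R)%type} := HB.pack Z mZ'.
pose PX : probability R R := distribution P X.
pose PY : probability R R := distribution P Y.
pose PZ : probability (R * R)%type R := distribution P Zm.
pose PXY : {measure set (R * R)%type -> \bar R} := (PX \x PY)%E.
have PZE S : measurable S -> PXY S = PZ S.
  apply: product_measure_unique => S1 S2 mS1 mS2.
  exact: XY_indep.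
pose f (z : R * R) : \bar R := (z.1 * z.2)%:E.
have mf : measurable_fun [set: R * R] f.
  by apply/measurable_EFinP; apply: measurable_funM.
have f_int : PZ.-integrable setT f by apply: integrable_pushforward.
have f_int' : PXY.-integrable setT f.
  apply/integrableP; split => //.
  rewrite (eq_measure_integral PZ) => [|S mS _]; last exact: PZE.
  by case/integrableP: f_int.
have -> : 'E_P[X \* Y]%E = (\int[PX]_x \int[PY]_y f (x, y))%E.
  rewrite [RHS]integral12_prod_meas1// (eq_measure_integral PZ); last first.
    by move=> S mS _; exact: PZE.
  by rewrite integral_pushforward// unlock.
have id_int (W : {RV P >-> R}) : P.-integrable setT (EFin \o W) ->
    (distribution P W).-integrable setT EFin.
  by move=> W_int; apply: integrable_pushforward => //; exact: EFin_measurable.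
have id_intE (W : {RV P >-> R}) : P.-integrable setT (EFin \o W) ->
    (\int[distribution P W]_x x%:E = 'E_P[W])%E.
  move=> W_int; rewrite integral_pushforward//.
  by rewrite preimage_setT unlock.
under eq_integral => x _.
  under eq_integral => y _ do rewrite /f /= EFinM.
  rewrite integralZl//; last exact: id_int.
  rewrite id_intE//.
  (* The inner integral is [x] times the expectation of [Y]. As that expectation is finite it is
     rewritten as a real number, the form in which [integralZr] can pull it out of the outer
     integral. *)
  rewrite -[X in (_ * X)%E]fineK; last first.
    by rewrite unlock; exact: integrable_fin_num.
  over.
rewrite integralZr//; last exact: id_int.
rewrite id_intE// fineK//.
by rewrite unlock; exact: integrable_fin_num.
Qed.

(** Integrability travels with the value because the expectation is total and extended real valued,
    and its linearity rests on integrability of every summand. *)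
Definition has_mean (d : measure_display) (T : measurableType d)
    (R : realType) (P : probability T R) (f : T -> R) (m : R) : Prop :=
  P.-integrable setT (EFin \o f) /\ 'E_P[f]%E = m%:E.

Section HasMean.
Variables (d : measure_display) (T : measurableType d) (R : realType).
Variable P : probability T R.

Lemma has_mean_cst (c : R) : has_mean P (fun=> c) c.
Proof.
split; last exact: expectation_cst.
exact: finite_measure_integrable_cst.
Qed.

Lemma has_meanD (f g : T -> R) (a b : R) :
  has_mean P f a -> has_mean P g b -> has_mean P (fun t => f t + g t) (a + b).
Proof.
move=> [f_int Ef] [g_int Eg]; split.
  exact: (integrableD measurableT f_int g_int).
rewrite unlock in Ef Eg *.
by rewrite (integralD_EFin measurableT f_int g_int) Ef Eg.
Qed.

Lemma has_meanZ (f : T -> R) (a c : R) :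
  has_mean P f a -> has_mean P (fun t => c * f t) (c * a).
Proof.
move=> [f_int Ef]; split; first exact: (integrableZl measurableT c f_int).
rewrite unlock in Ef *.
under eq_integral do rewrite EFinM.
by rewrite (integralZl measurableT f_int) Ef.
Qed.

Lemma has_mean_sum (I : Type) (s : seq I) (f : I -> T -> R) (a : I -> R) :
  (forall i, has_mean P (f i) (a i)) ->
  has_mean P (fun t => \sum_(i <- s) f i t) (\sum_(i <- s) a i).
Proof.
move=> fa; elim: s => [|i s IHs].
  rewrite big_nil; under eq_fun do rewrite big_nil; exact: has_mean_cst.
rewrite big_cons; under eq_fun do rewrite big_cons; exact: has_meanD.
Qed.

End HasMean.

(** * Second moments of linear images of the noise *)

Section Noise.
Variables (d : measure_display) (T : measurableType d) (R : realType).
Variables (P : probability T R) (n : nat) (eps : 'I_n -> {RV P >-> R}).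
Variable sigma : R.
Hypothesis eps_indep : mutually_independent eps.
Hypothesis eps_mean : forall r, 'E_P[eps r]%E = 0%E.
Hypothesis eps_var : forall r, 'V_P[eps r]%E = (sigma ^+ 2)%:E.

(** Centering identifies the variance with the integral of the square; the square is nonnegative, so
    the finite value already yields integrability. *)
Let sqr_eps (r : 'I_n) : has_mean P (fun t => eps r t * eps r t) (sigma ^+ 2).
Proof.
have Esqr : 'E_P[fun t => (eps r t * eps r t)%R]%E = (sigma ^+ 2)%:E.
  rewrite -(eps_var r) /variance [in RHS]unlock eps_mean; congr expectation.
  apply/funext => t; transitivity ((eps r t - 0) * (eps r t - 0)) => //.
  by rewrite subr0.
split => //; apply/integrableP; split.
  by apply/measurable_EFinP; exact: measurable_funM.
rewrite unlock in Esqr.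
under eq_integral => t _ do rewrite /= -expr2 ger0_norm ?sqr_ge0// expr2.
by rewrite Esqr ltry.
Qed.

(** The value 0 alone does not give integrability; the bound |x| <= 1 + x^2 does. *)
Let eps_has_mean (r : 'I_n) : has_mean P (eps r) 0.
Proof.
split => //.
have [sq_int _] := has_meanD (has_mean_cst P 1) (sqr_eps r).
apply: le_integrable sq_int => //; first exact/measurable_EFinP.
move=> t _ /=; rewrite lee_fin [leRHS]ger0_norm//; last first.
  by rewrite addr_ge0// -expr2 sqr_ge0.
by rewrite ler_norml; apply/andP; split; nra.
Qed.

(** Domination by |x y| <= x^2 + y^2. *)
Let epsM_integrable (r s : 'I_n) :
  P.-integrable setT (EFin \o (eps r \* eps s)).
Proof.
have [sq_int _] := has_meanD (sqr_eps r) (sqr_eps s).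
apply: le_integrable sq_int => //.
  by apply/measurable_EFinP; exact: measurable_funM.
move=> t _ /=; rewrite lee_fin [leRHS]ger0_norm//; last first.
  by rewrite addr_ge0// -expr2 sqr_ge0.
rewrite ler_norml; apply/andP; split; nra.
Qed.

Lemma epsM_has_mean (r s : 'I_n) :
  has_mean P (fun t => eps r t * eps s t) (sigma ^+ 2 *+ (r == s)).
Proof.
have [<-|rs] := eqVneq r s; first exact: sqr_eps.
split; first exact: epsM_integrable.
rewrite [LHS](expectationM_indep _ _ _ (epsM_integrable r s)); last 2 first.
- exact: (eps_has_mean r).1.
- exact: (eps_has_mean s).1.
  by rewrite !eps_mean mule0.
move=> S1 S2 mS1 mS2.
(* Mutual independence is used for the two-element family {r, s}, on which [S] takes the values [S1]
   and [S2]. *)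
pose S i := if i == r then S1 else S2.
have := eps_indep (J := [set r; s]%SET) (S := S).
rewrite big_setU1 ?inE//= big_set1 /S eqxx.
rewrite eq_sym (negPf rs) => <-; last by move=> i _; case: ifP.
congr (P _); apply/seteqP; split=> t /=.
  by move=> [tr ts] i; rewrite !inE => /orP[]/eqP->;
    rewrite ?eqxx// eq_sym (negPf rs).
move=> tJ; split; first by have := tJ r; rewrite eqxx !inE eqxx; apply.
by have := tJ s; rewrite eq_sym (negPf rs) !inE eqxx orbT; apply.
Qed.

(** In the coordinatewise expansion the terms linear in the noise have mean 0, and among the
    quadratic ones only the diagonal r = s survives, leaving the squared Frobenius norm of [M]. *)
Lemma expectation_sqr_enorm (p : nat) (a : 'cV[R]_p) (M : 'M[R]_(p, n)) :
  'E_P[fun t => (enorm (a + M *m \col_r eps r t) ^+ 2)%R]%E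
    = (\tr (a^T *m a) + sigma ^+ 2 * \tr (M *m M^T))%:E.
Proof.
(* This is the expanded square with each [eps r] replaced by 0 and each product of two coordinates
   by its mean, so that the [has_mean] rules apply term by term. *)
suff : has_mean P (fun t => enorm (a + M *m \col_r eps r t) ^+ 2)
   (\sum_j (a j ord0 ^+ 2 + \sum_r (2 * a j ord0 * M j r) * 0
     + \sum_r \sum_s M j r * M j s * (sigma ^+ 2 *+ (r == s)))).
  move=> [_ ->]; congr _%:E.
  rewrite trace_mx11 mxE mulr_sumr -big_split; apply: eq_bigr => j _ /=.
  rewrite !mxE -expr2 [X in _ + X + _]big1 ?addr0 => [|r _]; last exact: mulr0.
  congr (_ + _); rewrite mulr_sumr; apply: eq_bigr => r _.
  rewrite (bigD1 r)//= eqxx [X in _ + X]big1 ?addr0 => [|s]; last first.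
    by rewrite eq_sym => /negPf->; rewrite mulr0.
  by rewrite !mxE mulrC.
have -> : (fun t => enorm (a + M *m \col_r eps r t) ^+ 2) = (fun t =>
   \sum_j (a j ord0 ^+ 2 + \sum_r (2 * a j ord0 * M j r) * eps r t
     + \sum_r \sum_s M j r * M j s * (eps r t * eps s t))).
  apply/funext => t; rewrite /enorm sqr_sqrtr; last first.
    by apply: sumr_ge0 => i _; rewrite sqr_ge0.
  apply: eq_bigr => j _; rewrite !mxE sqrrD; congr (_ + _ + _).
    rewrite -mulrnAl mulr_sumr; apply: eq_bigr => r _; rewrite !mxE; ring.
  rewrite expr2 mulr_suml; apply: eq_bigr => r _.
  rewrite mulr_sumr; apply: eq_bigr => s _; rewrite !mxE; ring.
apply: has_mean_sum => j; apply: has_meanD; first apply: has_meanD.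
- exact: has_mean_cst.
- by apply: has_mean_sum => r; apply: has_meanZ.
- apply: has_mean_sum => r; apply: has_mean_sum => s.
  by apply: has_meanZ; exact: epsM_has_mean.
Qed.

End Noise.

(** * Traces of Gram matrices and invertibility of the regularized Gram matrix *)

Lemma mxscal_tr (R : realType) (M : 'M[R]_1) : mxscal M = \tr M.
Proof. by rewrite /mxscal trace_mx11. Qed.

Lemma mxtrace_mulT_ge0 (R : realType) (m n : nat) (M : 'M[R]_(m, n)) :
  0 <= \tr (M^T *m M).
Proof.
rewrite /mxtrace sumr_ge0// => i _; rewrite mxE sumr_ge0// => j _.
by rewrite !mxE -expr2 sqr_ge0.
Qed.

Lemma mxtrace_mulT_eq0 (R : realType) (m n : nat) (M : 'M[R]_(m, n)) :
  \tr (M^T *m M) = 0 -> M = 0.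
Proof.
have sum_ge0 j : 0 <= \sum_i M i j ^+ 2.
  by apply: sumr_ge0 => i _; rewrite sqr_ge0.
have -> : \tr (M^T *m M) = \sum_j \sum_i M i j ^+ 2.
  apply: eq_bigr => j _; rewrite mxE; apply: eq_bigr => i _.
  by rewrite !mxE expr2.
move=> /psumr_eq0P M0; apply/matrixP => i j; rewrite mxE.
have /psumr_eq0P Mj0 := M0 (fun j _ => sum_ge0 j) j isT.
by apply/eqP; rewrite -sqrf_eq0 Mj0// => l _; rewrite sqr_ge0.
Qed.

Lemma sqr_enorm (R : realType) (m : nat) (u : 'cV[R]_m) :
  enorm u ^+ 2 = \tr (u^T *m u).
Proof.
rewrite /enorm sqr_sqrtr; last by apply: sumr_ge0 => i _; rewrite sqr_ge0.
by rewrite trace_mx11 mxE; apply: eq_bigr => i _; rewrite !mxE expr2.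
Qed.

(** A row u in the left kernel satisfies c |X u^T|^2 + lam |u|^2 = 0. Both terms are nonnegative and
    lam > 0, so u = 0. *)
Lemma unitmx_gramD (R : realType) (m p : nat) (X : 'M[R]_(m, p)) (c lam : R) :
  0 <= c -> 0 < lam -> c *: (X^T *m X) + lam%:M \in unitmx.
Proof.
move=> c_ge0 lam_gt0; rewrite -row_free_unit; apply: inj_row_free => u uG0.
have : \tr (u *m (c *: (X^T *m X) + lam%:M) *m u^T) = 0.
  by rewrite uG0 mul0mx mxtrace0.
rewrite mulmxDr mulmxDl mxtraceD -scalemxAr -scalemxAl mxtraceZ.
rewrite mul_mx_scalar -scalemxAl mxtraceZ.
have -> : u *m (X^T *m X) *m u^T = (X *m u^T)^T *m (X *m u^T).
  by rewrite trmx_mul trmxK !mulmxA.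
have := mxtrace_mulT_ge0 (X *m u^T); have := mxtrace_mulT_ge0 u^T.
rewrite trmxK => u_ge0 Xu_ge0 /eqP.
rewrite paddr_eq0 ?mulr_ge0 ?(ltW lam_gt0)// => /andP[_].
rewrite mulf_eq0 (gt_eqF lam_gt0)/= => /eqP u0.
by rewrite -[u]trmxK (@mxtrace_mulT_eq0 _ _ _ u^T) ?trmx0// trmxK.
Qed.

(** * Ridge regression on a single block *)

Section RidgeBlock.
Variables (R : realType) (m p : nat) (X : 'M[R]_(m, p)) (lam : R).
Hypotheses (m_gt0 : (0 < m)%N) (lam_gt0 : 0 < lam).

Let G := Sigma_hat X + lam%:M.

Let unitG : G \in unitmx.
Proof. by apply: unitmx_gramD => //; rewrite invr_ge0. Qed.

Lemma trmx_Sigma_hat : (Sigma_hat X)^T = Sigma_hat X.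
Proof. by rewrite /Sigma_hat linearZ /= trmx_mul trmxK. Qed.

Let trmx_invG : (invmx G)^T = invmx G.
Proof. by rewrite trmx_inv linearD /= trmx_Sigma_hat tr_scalar_mx. Qed.

(** [Sigma_hat X] commutes with [G], which differs from it by a scalar matrix, hence also with the
    inverse of [G]; a product of commuting symmetric matrices is symmetric. *)
Lemma trmx_Q_block : (Q_block X lam)^T = Q_block X lam.
Proof.
have comm_G : G *m Sigma_hat X = Sigma_hat X *m G.
  by rewrite mulmxDl mulmxDr scalar_mxC.
rewrite /Q_block trmx_mul trmx_Sigma_hat trmx_invG.
by rewrite -[LHS](mulKmx unitG) [X in _ *m X]mulmxA comm_G mulmxK.
Qed.

(** The linear map through which the noise of a block enters its ridge estimator. *)
Definition noise_gain : 'M[R]_(p, m) := m%:R^-1 *: (invmx G *m X^T).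

Lemma ridge_response (beta : 'cV[R]_p) (e : 'cV[R]_m) :
  ridge X (X *m beta + e) lam = Q_block X lam *m beta + noise_gain *m e.
Proof.
have m_neq0 : m%:R != 0 :> R by rewrite pnatr_eq0 -lt0n.
(* Factoring out the block size passes from the unnormalized Gram matrix to [G]; this is where the
   block must be nonempty. *)
have mG : X^T *m X + (m%:R * lam)%:M = m%:R *: G.
  by rewrite scalerDr scalerA mulfV// scale1r -scale_scalar_mx.
rewrite /ridge mG invmxZ ?unitmxZ ?unitfE//.
rewrite mulmxDr /noise_gain /Q_block /Sigma_hat.
by rewrite -!scalemxAr -!scalemxAl !mulmxA.
Qed.

Lemma mxtrace_noise_gain :
  \tr (noise_gain *m noise_gain^T)
    = m%:R^-1 * \tr (invmx G ^+ 2 *m Sigma_hat X).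
Proof.
rewrite /noise_gain linearZ /= trmx_mul trmxK trmx_invG.
rewrite -scalemxAl -scalemxAr scalerA mxtraceZ -mulrA; congr (_ * _).
have -> : invmx G ^+ 2 = invmx G *m invmx G by rewrite expr2.
rewrite -mxtraceZ -[in RHS]mulmxA [RHS]mxtrace_mulC /Sigma_hat.
by rewrite -scalemxAr -scalemxAl !mulmxA.
Qed.

End RidgeBlock.

(** * Completing the square for a symmetric invertible matrix *)

Section CompleteSquare.
Variables (R : realType) (k : nat) (N : 'M[R]_k) (v : 'cV[R]_k) (c : R).
Hypotheses (unitN : N \in unitmx) (symN : N^T = N).

Let q (w : 'cV[R]_k) := \tr (w^T *m N *m w) - 2 * \tr (w^T *m v) + c.

Lemma complete_square (w : 'cV[R]_k) :
  q w = \tr ((w - invmx N *m v)^T *m N *m (w - invmx N *m v))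
        + (c - \tr (v^T *m invmx N *m v)).
Proof.
have -> : (w - invmx N *m v)^T = w^T - v^T *m invmx N.
  by rewrite linearB /= trmx_mul trmx_inv symN.
rewrite !(mulmxBl, mulmxBr) !mulmxA mulmxKV// -[_ *m N *m invmx N]mulmxA.
rewrite mulmxV// mulmx1 !linearB/= /q.
have -> : \tr (v^T *m w) = \tr (w^T *m v).
  by rewrite -mxtrace_tr trmx_mul trmxK.
ring.
Qed.

End CompleteSquare.

(** * Row selection and disjointness of the blocks *)

Lemma row_block_mulmx (R : realType) (n m p : nat) (b : {set 'I_n})
    (M : 'M[R]_(n, m)) (N : 'M[R]_(m, p)) :
  row_block b (M *m N) = row_block b M *m N.
Proof. by rewrite /row_block mul_rowsub_mx. Qed.

(** Selection becomes left multiplication by rows of the identity. These rows are orthonormal, so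
    the next two lemmas reduce block interactions to products equal to the identity or to 0. *)
Lemma row_blockE (R : realType) (n m : nat) (b : {set 'I_n})
    (M : 'M[R]_(n, m)) : row_block b M = row_block b 1%:M *m M.
Proof. by rewrite -row_block_mulmx mul1mx. Qed.

Lemma row_block1_mulT (R : realType) (n : nat) (b : {set 'I_n}) :
  row_block b (1%:M : 'M[R]_n) *m (row_block b 1%:M)^T = 1%:M.
Proof.
rewrite -row_blockE; apply/matrixP => i j; rewrite !mxE.
by rewrite (inj_eq enum_val_inj) eq_sym.
Qed.

Lemma row_block1_mulT_disjoint (R : realType) (n : nat) (b c : {set 'I_n}) :
  [disjoint b & c] -> row_block b (1%:M : 'M[R]_n) *m (row_block c 1%:M)^T = 0.
Proof.
move=> bc; rewrite -row_blockE; apply/matrixP => i j; rewrite !mxE.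
case: eqP => // ji; have := disjointFr bc (enum_valP i).
by rewrite -ji enum_valP.
Qed.

Lemma row_partition_card_gt0 (n k : nat) (B : 'I_k -> {set 'I_n}) i :
  is_row_partition B -> (0 < #|B i|)%N.
Proof.
move=> [_ /and3P[_ _ B0]]; rewrite card_gt0; apply: contraNneq B0 => <-.
exact: imset_f.
Qed.

(** A partition only separates blocks that differ as sets; injectivity of [B] turns distinct labels
    into distinct sets. *)
Lemma row_partition_disjoint (n k : nat) (B : 'I_k -> {set 'I_n}) i j :
  is_row_partition B -> i != j -> [disjoint B i & B j].
Proof.
move=> [B_inj /and3P[_ /finset.trivIsetP B_triv _]] ij.
by apply: B_triv; rewrite ?imset_f// (inj_eq B_inj).
Qed.

(** * Bias and noise of the distributed estimator *)

Section DistRidge.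
Variables (R : realType) (n p k : nat) (X : 'M[R]_(n, p)) (beta : 'cV[R]_p).
Variables (B : 'I_k -> {set 'I_n}) (lam : 'I_k -> R) (sigma : R).
Hypothesis B_part : is_row_partition B.
Hypothesis lam_gt0 : forall i, 0 < lam i.

Let Xb i := row_block (B i) X.
Let Q i := Q_block (Xb i) (lam i).
Let A := A_mx X B lam beta.
Let Rm := R_mx X B lam sigma.
Let v := v_vec X B lam beta.

Let B_gt0 i : (0 < #|B i|)%N. Proof. exact: row_partition_card_gt0. Qed.

(** The matrix U of the overview: column i is the noise-free value of the i-th local estimator. *)
Definition shrunk_signal : 'M[R]_(p, k) := \matrix_(l, i) (Q i *m beta) l ord0.

(** The matrix M(w) of the overview. The selection matrix extends each block gain by zero columns,
    so that all of them act on the full noise vector. *)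
Definition noise_map (w : 'cV[R]_k) : 'M[R]_(p, n) :=
  \sum_i w i ord0 *: (noise_gain (Xb i) (lam i) *m row_block (B i) 1%:M).

Lemma dist_ridge_error (w : 'cV[R]_k) (e : 'cV[R]_n) :
  dist_ridge X (X *m beta + e) B lam w - beta
    = (shrunk_signal *m w - beta) + noise_map w *m e.
Proof.
rewrite addrAC; congr (_ - _).
have -> : shrunk_signal *m w = \sum_i w i ord0 *: (Q i *m beta).
  apply/colP => l; rewrite summxE !mxE; apply: eq_bigr => i _.
  by rewrite !mxE mulrC.
rewrite /dist_ridge /noise_map mulmx_suml -big_split; apply: eq_bigr => i _ /=.
rewrite -scalemxAl -scalerDr; congr (_ *: _).
rewrite -mulmxA -row_blockE -ridge_response//; congr ridge.
by rewrite row_blockE mulmxDr -!row_blockE row_block_mulmx.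
Qed.

(** Symmetry of the left factor Q_i lets it act on the left copy of beta, so each entry is an inner
    product of two columns. *)
Lemma A_mx_gram : A = shrunk_signal^T *m shrunk_signal.
Proof.
apply/matrixP => i j; rewrite mxE.
rewrite -[in LHS](trmx_Q_block (Xb i) (lam_gt0 i)) -/(Q i) -/(Q j).
rewrite -trmx_mul -mulmxA /mxscal mxE [RHS]mxE.
by apply: eq_bigr => l _; rewrite !mxE.
Qed.

Lemma v_vec_gram : v = shrunk_signal^T *m beta.
Proof.
apply/colP => i; rewrite mxE.
rewrite -[in LHS](trmx_Q_block (Xb i) (lam_gt0 i)) -/(Q i).
rewrite -trmx_mul /mxscal mxE [RHS]mxE.
by apply: eq_bigr => l _; rewrite !mxE.
Qed.

Lemma R_mxE i j : let L := noise_gain (Xb i) (lam i) in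
  Rm i j = (sigma ^+ 2 * \tr (L *m L^T)) *+ (i == j).
Proof.
rewrite /= mxtrace_noise_gain// !mxE; case: eqP => [->|]; last by rewrite !mulr0n.
by rewrite !mulr1n [RHS]mulrCA mulrA.
Qed.

Lemma noise_map_gram (w : 'cV[R]_k) :
  sigma ^+ 2 * \tr (noise_map w *m (noise_map w)^T) = \tr (w^T *m Rm *m w).
Proof.
transitivity (\sum_i w i ord0 ^+ 2 * Rm i i).
  rewrite /noise_map mulmx_suml raddf_sum mulr_sumr; apply: eq_bigr => i _ /=.
  rewrite R_mxE eqxx mulr1n mulrCA; congr (_ * _).
  (* Only j = i contributes: for other j the selection matrices of disjoint blocks multiply to 0. *)
  rewrite linear_sum /= mulmx_sumr (bigD1 i)//= big1 ?addr0 => [|j ji].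
    rewrite linearZ /= -scalemxAl -scalemxAr scalerA mxtraceZ -expr2.
    congr (_ * \tr _); rewrite trmx_mul mulmxA.
    rewrite -[_ *m _ *m (row_block _ _)^T]mulmxA.
    by rewrite row_block1_mulT mulmx1.
  rewrite linearZ /= -scalemxAl -scalemxAr trmx_mul mulmxA.
  rewrite -[_ *m _ *m (row_block _ _)^T]mulmxA row_block1_mulT_disjoint.
    by rewrite mulmx0 mul0mx !scaler0.
  by apply: row_partition_disjoint; rewrite // eq_sym.
rewrite trace_mx11 mxE; apply: eq_bigr => i _.
rewrite [in RHS]mxE (bigD1 i)//= big1 ?addr0 => [|j ji].
  by rewrite [in RHS]mxE expr2 mulrAC.
by rewrite R_mxE (negPf ji) mulr0.
Qed.

Lemma AR_sym : (A + Rm)^T = A + Rm.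
Proof.
rewrite linearD /= A_mx_gram trmx_mul trmxK; congr (_ + _).
by rewrite /Rm /R_mx tr_diag_mx.
Qed.

(** Writing the form as a sum of squares makes its positivity visible and matches the terms of the
    mean squared error. *)
Lemma AR_quad (w : 'cV[R]_k) : \tr (w^T *m (A + Rm) *m w)
  = \tr ((shrunk_signal *m w)^T *m (shrunk_signal *m w))
    + sigma ^+ 2 * \tr (noise_map w *m (noise_map w)^T).
Proof.
by rewrite noise_map_gram mulmxDr mulmxDl mxtraceD A_mx_gram trmx_mul !mulmxA.
Qed.

Lemma AR_quad_ge0 (w : 'cV[R]_k) : 0 <= \tr (w^T *m (A + Rm) *m w).
Proof.
rewrite AR_quad addr_ge0 ?mxtrace_mulT_ge0// mulr_ge0 ?sqr_ge0//.
by rewrite -[X in X *m _]trmxK mxtrace_mulT_ge0.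
Qed.

End DistRidge.

(** * The mean squared error as a quadratic form and its minimizer *)

(** A semidefinite form that vanishes at w is minimal there, so its gradient, proportional to N w,
    vanishes. The test vector moves from w against u = N w; the weights c + 1 and g avoid a division
    by c, which may be 0. *)
Lemma psd_quad_eq0 (R : realType) (k : nat) (N : 'M[R]_k) (w : 'cV[R]_k) :
  N^T = N -> (forall u : 'cV[R]_k, 0 <= \tr (u^T *m N *m u)) ->
  \tr (w^T *m N *m w) = 0 -> N *m w = 0.
Proof.
move=> symN N_ge0 wNw0.
have NwT : (N *m w)^T = w^T *m N by rewrite trmx_mul symN.
apply: mxtrace_mulT_eq0; set u := N *m w; set g := \tr _.
set c := \tr (u^T *m N *m u).
(* The form takes the value - g^2 (c + 2) at this vector. *)
have := N_ge0 ((c + 1) *: w - g *: u).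
have -> : ((c + 1) *: w - g *: u)^T = (c + 1) *: w^T - g *: u^T.
  by rewrite linearB /= !linearZ.
rewrite !(mulmxBl, mulmxBr) -!(scalemxAl, scalemxAr) !raddfB /= !mxtraceZ.
rewrite wNw0 -NwT -/u -/g -[u^T *m N *m w]mulmxA -/u -/g -/c.
have c_ge0 : 0 <= c by exact: N_ge0.
move=> h; apply/eqP; rewrite -sqrf_eq0 eq_le sqr_ge0 andbT.
have : g ^+ 2 * (c + 2) <= 0 by nra.
by rewrite pmulr_lle0// ltr_wpDl.
Qed.

Lemma MSE_quadratic (d : measure_display) (T : measurableType d)
    (R : realType) (P : probability T R) (n p k : nat) (X : 'M[R]_(n, p))
    (beta : 'cV[R]_p) (eps : 'I_n -> {RV P >-> R}) (sigma : R)
    (B : 'I_k -> {set 'I_n}) (lam : 'I_k -> R) (w : 'cV[R]_k) :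
  mutually_independent eps ->
  (forall r, 'E_P[eps r]%E = 0%E) ->
  (forall r, 'V_P[eps r]%E = (sigma ^+ 2)%:E) ->
  is_row_partition B -> (forall i, 0 < lam i) ->
  MSE X beta eps B lam w =
    (\tr (w^T *m (A_mx X B lam beta + R_mx X B lam sigma) *m w)
     - 2 * \tr (w^T *m v_vec X B lam beta) + enorm beta ^+ 2)%:E.
Proof.
move=> eps_indep eps_mean eps_var B_part lam_gt0.
rewrite /MSE /response; under eq_fun do rewrite dist_ridge_error//.
rewrite (expectation_sqr_enorm eps_indep eps_mean eps_var); congr _%:E.
rewrite AR_quad// v_vec_gram// sqr_enorm; set u := _ *m w.
have -> : w^T *m ((shrunk_signal X beta B lam)^T *m beta) = u^T *m beta.
  by rewrite trmx_mul mulmxA.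
have -> : (u - beta)^T = u^T - beta^T by rewrite linearB.
rewrite !(mulmxBl, mulmxBr) !raddfB /=.
have -> : \tr (beta^T *m u) = \tr (u^T *m beta).
  by rewrite -mxtrace_tr trmx_mul trmxK.
ring.
Qed.

Theorem theorem2p1 (d : measure_display) (T : measurableType d) (R : realType)
    (P : probability T R) (n p k : nat)
    (X : 'M[R]_(n, p)) (beta : 'cV[R]_p)
    (eps : 'I_n -> {RV P >-> R}) (sigma : R)
    (eps_indep : mutually_independent eps)
    (eps_mean : forall r, 'E_P[eps r]%E = 0%E)
    (eps_var : forall r, 'V_P[eps r]%E = (sigma ^+ 2)%:E)
    (B : 'I_k -> {set 'I_n}) (B_part : is_row_partition B)
    (lam : 'I_k -> R) (lam_gt0 : forall i, 0 < lam i)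
    (AR_unit : A_mx X B lam beta + R_mx X B lam sigma \in unitmx) :
  let A := A_mx X B lam beta in
  let Rm := R_mx X B lam sigma in
  let v := v_vec X B lam beta in
  let wstar : 'cV[R]_k := invmx (A + Rm) *m v in
  (forall w : 'cV[R]_k,
     (forall w' : 'cV[R]_k,
        (MSE X beta eps B lam w <= MSE X beta eps B lam w')%E)
     <-> w = wstar) /\
  MSE X beta eps B lam wstar =
    (enorm beta ^+ 2 - mxscal (v^T *m invmx (A + Rm) *m v))%:E.
Proof.
move=> A Rm v wstar.
(* Only the first term depends on [w]; it is nonnegative and vanishes at [wstar]. *)
have MSEE w : MSE X beta eps B lam w =
    (\tr ((w - wstar)^T *m (A + Rm) *m (w - wstar))
     + (enorm beta ^+ 2 - \tr (v^T *m invmx (A + Rm) *m v)))%:E.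
  rewrite (MSE_quadratic X beta w eps_indep eps_mean eps_var B_part lam_gt0).
  by rewrite (complete_square _ _ AR_unit)// AR_sym.
have N_ge0 (w : 'cV[R]_k) : 0 <= \tr (w^T *m (A + Rm) *m w).
  exact: (AR_quad_ge0 X beta sigma B_part lam_gt0).
have quad_wstar : \tr ((wstar - wstar)^T *m (A + Rm) *m (wstar - wstar)) = 0.
  by rewrite subrr mulmx0 mxtrace0.
split; last by rewrite MSEE quad_wstar add0r mxscal_tr.
move=> w; split=> [w_min|-> w'].
  (* Comparison with [wstar] forces the form to vanish at [w - wstar]. Semidefiniteness puts this
     difference in the kernel of [A + Rm], which is trivial by invertibility. *)
  have := w_min wstar; rewrite !MSEE lee_fin quad_wstar lerD2r => quad_le0.
  have quad0 : \tr ((w - wstar)^T *m (A + Rm) *m (w - wstar)) = 0.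
    by apply/eqP; rewrite eq_le quad_le0 N_ge0.
  have := psd_quad_eq0 (AR_sym X beta B sigma lam_gt0) N_ge0 quad0.
  move=> /(congr1 (mulmx (invmx (A + Rm)))).
  by rewrite mulKmx// mulmx0 => /subr0_eq.
by rewrite !MSEE lee_fin quad_wstar lerD2r N_ge0.
Qed.
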